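(* Let $\alpha\in(0,1)$. The set of functions $f \in C^{\alpha}[0,1]$ such that $h_{f}(x) = \alpha$ for every $x \in [0,1]$ is not $1$-algebrable.
   Context: $C^{\alpha}[0,1]$ is the set of functions $f:[0,1]\to\mathbb{R}$ for which there is $C>0$ with $|f(x)-f(y)|\le C|x-y|^{\alpha}$ for all $x,y\in[0,1]$; it is an algebra under pointwise operations. Hölder exponent: let $f:[0,1]\to\mathbb{R}$ be locally bounded, $x_0\in[0,1]$ and $\beta\ge0$. We write $f\in C^{\beta}(x_0)$ if there exist a constant $C>0$ and a polynomial $P_{x_0}$ of degree at most $[\beta]$ (integer part), both depending on $x_0$, such that $|f(x)-P_{x_0}(x)|\le C|x-x_0|^{\beta}$ for every $x$ in a neighborhood of $x_0$ (in $[0,1]$). The Hölder exponent of $f$ at $x_0$ is $h_f(x_0)=\sup\{\beta\ge0 : f\in C^{\beta}(x_0)\}\in[0,+\infty]$. Algebrability: a subset $\mathcal{B}$ of an algebra $\mathcal{A}$ is $\kappa$-algebrable ($\kappa$ a cardinal) if $\mathcal{B}\cup\{0\}$ contains a $\kappa$-generated subalgebra of $\mathcal{A}$, where $\kappa$-generated means having a minimal system of generators of cardinality $\kappa$. Subalgebras need not contain a unit: the subalgebra generated by $f$ consists of all $P(f)$ with $P$ a real polynomial without constant term. In particular, a $1$-generated subalgebra is the subalgebra generated by a single nonzero element (the zero algebra does not count as $1$-generated). *)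

(* Defs.v *)
(* The real numbers are an arbitrary [R : realType] of MathComp-Analysis. *)
From HB Require Import structures.
From mathcomp Require Import all_boot all_order all_algebra.
From mathcomp Require Import all_classical all_reals all_analysis.

Set Implicit Arguments.
Unset Strict Implicit.
Unset Printing Implicit Defensive.

Import Order.TTheory GRing.Theory Num.Theory.
Import numFieldNormedType.Exports.
Local Open Scope classical_set_scope.
Local Open Scope ring_scope.

Section function_algebra.
Variables (T : pointedType) (K : comNzRingType) (A : comAlgType K).

Fact fct_scalerAl (a : K) (f g : T -> A) : a *: (f * g) = (a *: f) * g.
Proof. by apply/funext => x; rewrite /= [LHS]scalerAl. Qed.

HB.instance Definition _ :=
  GRing.LSemiModule_isLSemiAlgebra.Build K (T -> A) fct_scalerAl.
HB.instance Definition _ :=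
  GRing.Lalgebra_isComAlgebra.Build K (T -> A).

End function_algebra.

Section algebrability.
Variables (K : comNzRingType) (A : algType K).
Implicit Types (B M S : set A).

(* A subalgebra need not contain the unit of [A], so this is weaker than
   [GRing.subalg_closed]. *)
Definition is_subalgebra M :=
  [/\ M 0,
      forall u v, M u -> M v -> M (u + v),
      forall (a : K) u, M u -> M (a *: u)
    & forall u v, M u -> M v -> M (u * v)].

Definition generated_subalgebra S : set A := smallest is_subalgebra S.

Definition minimal_generators M S :=
  generated_subalgebra S = M /\
  forall S', S' `<` S -> generated_subalgebra S' <> M.

(* The cardinal is given by a set [kappa] having that cardinality. As the
   empty set generates the zero algebra, the latter is 0-generated and not
   1-generated. *)
Definition kappa_generated U (kappa : set U) M :=
  exists2 S, (S #= kappa)%card & minimal_generators M S.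

Definition algebrable U (kappa : set U) B :=
  exists M, [/\ is_subalgebra M, M `<=` B `|` [set 0] & kappa_generated kappa M].

End algebrability.

Definition unit_interval (R : realType) : Type := `[0 : R, 1 : R]%classic.

Section unit_interval_instances.
Variable R : realType.

Fact zero_in_unit_interval : (0 : R) \in `[0 : R, 1 : R]%classic.
Proof. by rewrite inE /= in_itv /= lexx ler01. Qed.

HB.instance Definition _ :=
  PseudoMetric.copy (unit_interval R) (set_type `[0 : R, 1 : R]%classic).
HB.instance Definition _ := isPointed.Build (unit_interval R)
  (exist _ 0 zero_in_unit_interval : set_type `[0 : R, 1 : R]%classic).

Definition pt (x : unit_interval R) : R := set_val x.

Fact pt_itv (x : unit_interval R) : 0 <= pt x <= 1.
Proof. by have := set_valP x; rewrite /= in_itv. Qed.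

End unit_interval_instances.

Coercion pt : unit_interval >-> Real.sort.

Section holder_space.
Variables (R : realType) (alpha : R) (alpha0 : 0 < alpha).

(* The proof of [0 < alpha] is carried along because it is needed for the
   products of Hoelder functions to be Hoelder. *)
Definition holder_pred of 0 < alpha : {pred unit_interval R -> R} :=
  fun f => `[< exists2 C : R, 0 < C &
    forall x y : unit_interval R,
      `|f x - f y| <= C * `|(x : R) - (y : R)| `^ alpha >].

Record holder_fun := HolderFun {
  holder_val :> unit_interval R -> R ;
  holder_valP : holder_val \in holder_pred alpha0 }.

HB.instance Definition _ := [isSub for holder_val].
HB.instance Definition _ := [Choice of holder_fun by <:].

Let holder_bounded f : f \in holder_pred alpha0 ->
  exists2 M : R, 0 < M & forall x, `|f x| <= M.
Proof.
move=> /asboolP[C C0 fC]; exists (C + `|f point|).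
  by rewrite ltr_pwDl.
move=> x; rewrite -lerBlDr (le_trans (lerB_dist _ _))// (le_trans (fC _ _))//.
rewrite -[leRHS]mulr1 ler_wpM2l ?(ltW C0)//.
rewrite [leRHS](_ : _ = 1 `^ alpha); last by rewrite powR1.
rewrite ge0_ler_powR ?(ltW alpha0) ?nnegrE//.
have -> : pt (point : unit_interval R) = 0 by [].
by have /andP[x0 x1] := pt_itv x; rewrite subr0 ger0_norm.
Qed.

Fact holder_subalg_closed : subalg_closed (holder_pred alpha0).
Proof.
split.
- apply/asboolP; exists 1 => // x y.
  by rewrite subrr normr0 mul1r powR_ge0.
- move=> a f g /asboolP[C C0 fC] /asboolP[D D0 gD].
  apply/asboolP; exists (`|a| * C + D).
    by rewrite ltr_wpDl// mulr_ge0// ltW.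
  move=> x y; rewrite /= !fctE.
  rewrite (_ : _ - _ = a * (f x - f y) + (g x - g y)); last first.
    by rewrite mulrBr opprD addrACA.
  rewrite (le_trans (ler_normD _ _))// mulrDl lerD// normrM -mulrA.
  by rewrite ler_wpM2l.
- move=> f g fh gh.
  have [M M0 fM] := holder_bounded fh; have [N N0 gN] := holder_bounded gh.
  move: fh gh => /asboolP[C C0 fC] /asboolP[D D0 gD].
  apply/asboolP; exists (M * D + N * C); first by rewrite addr_gt0// mulr_gt0.
  move=> x y; rewrite /= !fctE.
  rewrite (_ : _ - _ = f x * (g x - g y) + g y * (f x - f y)); last first.
    by rewrite !mulrBr (mulrC (g y) (f x)) addrA subrK (mulrC (g y)).
  rewrite (le_trans (ler_normD _ _))// mulrDl lerD// normrM -mulrA ler_pM//.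
Qed.

HB.instance Definition _ := GRing.isSubalgClosed.Build R (unit_interval R -> R)
  (holder_pred alpha0) holder_subalg_closed.
HB.instance Definition _ := [SubChoice_isSubComNzRing of holder_fun by <:].
HB.instance Definition _ := [SubZmodule_isSubLmodule of holder_fun by <:].
HB.instance Definition _ :=
  [SubNzRing_SubLmodule_isSubLalgebra of holder_fun by <:].
HB.instance Definition _ := [SubLalgebra_isSubAlgebra of holder_fun by <:].

End holder_space.

Section holder_exponent.
Variable R : realType.
Implicit Types (f : unit_interval R -> R) (x : unit_interval R).

(* [size P] is one more than the degree of [P]. The neighborhoods of [x0] are
   taken in [0, 1], and 0 `^ 0 = 1. *)
Definition pointwise_holder f (x0 : unit_interval R) (beta : R) :=
  exists C : R, exists P : {poly R},
    [/\ 0 < C, (size P <= (Num.truncn beta).+1)%N &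
        \forall x \near x0, `|f x - P.[x : R]| <= C * `|(x : R) - (x0 : R)| `^ beta].

Definition holder_exponent f x : \bar R :=
  ereal_sup [set beta%:E | beta in
    [set beta : R | 0 <= beta /\ pointwise_holder f x beta]].

End holder_exponent.

(* Main.v *)
(* A minimal system of generators never contains 0, so a 1-generated subalgebra
   contains some f <> 0, and f is not constant because a constant has Hoelder
   exponent at least 1. Choose x0 and y with f y <> 0 and f y <> f x0. Then
   g = f (f - f x0)^2 is a polynomial in f without constant term, g y <> 0, and
   g = O(|x - x0|^(2 alpha)), so the Hoelder exponent of g at x0 is at least
   2 alpha > alpha. *)
Require Import Defs.
From mathcomp Require Import all_boot all_order all_algebra.
From mathcomp Require Import all_classical all_reals all_analysis.
From mathcomp Require Import ring.

Import Order.TTheory GRing.Theory Num.Theory.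

Local Open Scope classical_set_scope.
Local Open Scope ring_scope.

Section generators.
Context {K : comNzRingType} {A : algType K}.
Implicit Types S M : set A.

Lemma is_subalgebra_generated S : is_subalgebra (generated_subalgebra S).
Proof.
split=> [M [[]]//|u v Su Sv M SM|a u Su M SM|u v Su Sv M SM];
  have [[_ MD MZ MM] _] := SM.
- by apply: MD; [exact: Su|exact: Sv].
- by apply: MZ; exact: Su.
- by apply: MM; [exact: Su|exact: Sv].
Qed.

(** Every subalgebra contains 0, so removing 0 from [S] leaves the generated subalgebra unchanged,
    against minimality. *)
Lemma minimal_generators_neq0 M S u : minimal_generators M S -> S u -> u != 0.
Proof.
move=> [genS minS] Su; apply/eqP => u0; rewrite {}u0 in Su.
apply: (minS (S `\ 0)).
  by split=> [x []//|/(_ _ Su)[_]]; apply.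
rewrite -genS; apply/seteqP; split; apply: smallest_sub.
- exact: is_subalgebra_generated.
- by move=> x [Sx _]; exact: sub_gen_smallest.
- exact: is_subalgebra_generated.
- move=> x Sx; have [->|/eqP x0] := eqVneq x 0.
    by have [] := is_subalgebra_generated (S `\ 0).
  by apply: sub_gen_smallest.
Qed.

End generators.

Lemma pointwise_holder_le_exponent (R : realType) (f : unit_interval R -> R)
    (x : unit_interval R) (beta : R) : 0 <= beta ->
  pointwise_holder f x beta -> (beta%:E <= holder_exponent f x)%E.
Proof. by move=> beta0 fx; apply: ereal_sup_ubound; exists beta. Qed.

Lemma pointwise_holder_cst (R : realType) (c : R) (x : unit_interval R)
  (beta : R) : pointwise_holder (fun=> c) x beta.
Proof.
exists 1, c%:P; split=> //; first by rewrite (leq_trans (size_polyC_leq1 _)).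
by apply: (@nearW _ (nbhs x)) => y; rewrite hornerC subrr normr0 mul1r powR_ge0.
Qed.

(** Compare [f x] with the value at the base point 0: the distance is at most 1, and so is its power
    [alpha]. *)
Lemma holder_fun_bounded (R : realType) (alpha : R) (alpha_gt0 : 0 < alpha)
    (f : holder_fun alpha_gt0) :
  exists2 M : R, 0 < M & forall x, `|f x| <= M.
Proof.
have /asboolP[C C0 fC] := holder_valP f.
exists (C + `|f point|) => [|x]; first by rewrite ltr_pwDl.
rewrite -lerBlDr (le_trans (lerB_dist _ _))// (le_trans (fC _ _))//.
rewrite ler_piMr ?(ltW C0)//.
have -> : 1 = 1 `^ alpha by rewrite powR1.
rewrite ge0_ler_powR ?(ltW alpha_gt0) ?nnegrE//.
have -> : pt (point : unit_interval R) = 0 by [].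
by have /andP[x0 x1] := pt_itv x; rewrite subr0 ger0_norm.
Qed.

(** The factor [f x] is bounded and each factor [f x - f x0] is of order [alpha] at [x0]. The
    approximating polynomial is 0, so the degree bound holds whatever the integer part of
    [alpha + alpha]. *)
Lemma pointwise_holder_sqr (R : realType) (alpha : R) (alpha_gt0 : 0 < alpha)
    (f : holder_fun alpha_gt0) (x0 : unit_interval R) :
  pointwise_holder (fun x => f x * (f x - f x0) ^+ 2) x0 (alpha + alpha).
Proof.
have /asboolP[C C0 fC] := holder_valP f.
have [M M0 fM] := holder_fun_bounded _ _ _ f.
exists (M * C ^+ 2), 0; split.
- by rewrite mulr_gt0// exprn_gt0.
- by rewrite size_poly0.
- apply: (@nearW _ (nbhs x0)) => x; rewrite horner0 subr0 normrM normrX -mulrA.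
  apply: ler_pM => //.
  (* At [x = x0] the base is 0, and the power splits there because the total exponent is nonzero. *)
  rewrite powRD; last by rewrite gt_eqF ?addr_gt0.
  rewrite -expr2 -exprMn ler_pXn2r ?nnegrE//.
  by rewrite mulr_ge0 ?powR_ge0 ?ltW.
Qed.

Theorem corollary4p4 (R : realType) (alpha : R)
    (alpha_gt0 : 0 < alpha) (alpha_lt1 : alpha < 1) :
  ~ algebrable `I_1
      [set f : holder_fun alpha_gt0 |
        forall x : unit_interval R, holder_exponent f x = alpha%:E].
Proof.
move=> [M [[M0 MD MZ MM] MB [S cardS minS]]].
have [f Sf] : exists f, S f.
  apply/set0P/eqP => S0; move: cardS; rewrite S0 => /card_esym.
  by rewrite II1 card_eq0 => /eqP/seteqP[/(_ 0%N erefl)].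
have f0 := minimal_generators_neq0 _ _ _ minS Sf.
have Mf : M f by case: minS => <- _; exact: sub_gen_smallest.
have exponentE g : M g -> g <> 0 -> forall x, holder_exponent g x = alpha%:E.
  by move=> /MB[].
have [y0 fy0] : exists y, f y <> 0.
  apply: contrapT => /forallNP fE; move/eqP: f0; apply.
  by apply/val_inj/funext => x; apply: contrapT => /fE.
have [z0 fz0] : exists z, f z <> f y0.
  apply: contrapT => /forallNP fE.
  have fcst : f = (fun=> f y0) :> (_ -> _).
    by apply/funext => z; apply: contrapT => /fE.
  have := pointwise_holder_le_exponent _ f y0 1 ler01.
  rewrite exponentE//; last exact/eqP.
  rewrite fcst lee_fin => /(_ (pointwise_holder_cst _ _ _ _)).
  by rewrite leNgt alpha_lt1.
set c := f z0.
(* This is [f * (f - c) ^+ 2] expanded into monomials in [f]: the constant [c] may lie outside [M],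
   which need not contain the unit. *)
pose g : holder_fun alpha_gt0 :=
  f * f * f + (- (c + c)) *: (f * f) + (c * c) *: f.
have gE x : g x = f x * (f x - c) ^+ 2.
  rewrite (_ : g x = f x * f x * f x + (- (c + c)) * (f x * f x) + (c * c) * f x) //.
  by ring.
have Mg : M g.
  have Mff := MM _ _ Mf Mf.
  exact: MD (MD _ _ (MM _ _ Mff Mf) (MZ _ _ Mff)) (MZ _ _ Mf).
have g0 : g <> 0.
  (* At [y0] neither factor vanishes, by the choice of [y0] and [z0]. *)
  move=> /(congr1 (fun h : holder_fun alpha_gt0 => h y0)); rewrite gE.
  rewrite [RHS](_ : _ = 0)// => /eqP; rewrite mulf_eq0 expf_eq0/= subr_eq0.
  by move=> /orP[/eqP//|/eqP/esym].
have alpha2_ge0 : 0 <= alpha + alpha by rewrite ltW// addr_gt0.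
have := pointwise_holder_le_exponent _ g z0 _ alpha2_ge0.
rewrite exponentE// lee_fin leNgt ltr_pwDl//.
have -> : (g : _ -> _) = (fun x => f x * (f x - c) ^+ 2) by exact/funext.
by move=> /(_ (pointwise_holder_sqr _ _ _ _ _)).
Qed.
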